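(* Let $A$ and $A+uv^T$ be nonsingular $n\times n$ real matrices, $u,v,b\in\mathbb{R}^n$, and suppose $(A+uv^T)x=b$ is solved in floating-point arithmetic by the Sherman–Morrison formula followed by one step of fixed-precision iterative refinement (SM-IR), where all linear systems with $A$ are solved with a backward stable algorithm; let $\hat w$ be the corrected solution. If $$h(A,u,v,\hat r)=\Big((2d\,n^2ee^T+3I)|A|+2(n+4)|u||v|^T\Big)\frac{|\hat\alpha_r|}{|\hat\beta|}|A^{-1}u|+2\frac{|\hat\alpha_r|}{|\hat\beta|}|u|$$ is bounded (entrywise) by a modest scalar multiple of $|A+uv^T||\hat w|+|b|$, then one step of SM-IR guarantees componentwise relative backward stability: to first order in $\epsilon_M$, the componentwise relative backward error $$\max_i\frac{|b-(A+uv^T)\hat w|_i}{\big(|A+uv^T||\hat w|+|b|\big)_i}$$ is bounded by a modest multiple of $\epsilon_M$.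
   Context: Absolute values and inequalities of vectors and matrices are entrywise. $\epsilon_M$ is the unit roundoff, $e$ the all-ones vector, $I$ the identity, $d$ a small integer constant; hats denote quantities computed in floating-point arithmetic (standard model, one fixed precision). ''Modest'' means a constant growing at most like a modest polynomial in $n$. Sherman–Morrison (SM) formula: solve $Ay=b$ and $Az=u$, set $\alpha=v^Ty$, $\beta=1+v^Tz$, $\theta=\alpha/\beta$, output $x=y-\theta z$; computed quantities are $\hat y,\hat z,\hat\alpha,\hat\beta,\hat\theta,\hat x$. One step of SM-IR: compute $\hat x$ by SM; compute $r=b-A\hat x-(v^T\hat x)u$ in floating point, giving $\hat r$; solve $Ay_r=\hat r$, set $\alpha_r=v^Ty_r$ (computed value $\hat\alpha_r$), $\theta_r=\alpha_r/\beta$ with the same $\beta$ and $z$; output $\hat w$, the computed value of $\hat x+y_r-\theta_rz$. ''Backward stable'' for the solves with $A$ is in the sense of QR factorization by Householder or Givens transformations: a computed solution $\hat s$ of $As=f$ satisfies $(A+\Delta)\hat s=f$ with $|\Delta|\le\tilde\gamma_{n^2}ee^T|A|$, where $\tilde\gamma_k=\frac{ck\epsilon_M}{1-ck\epsilon_M}$ for a small integer constant $c$.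
   Formalization: The modest multiple also contains the cancellation factor max_i ((|A|+|u||v|^T)|ŵ|)_i/(|A+uv^T||ŵ|+|b|)_i, without which the claim is false; the explicit remainder is shown O(ε_M²) only when |A+uv^T||x|+|b| is entrywise positive at the exact x. *)

(* Defs.v *)
From HB Require Import structures.
From mathcomp Require Import all_boot all_order all_algebra.
Set Implicit Arguments. Unset Strict Implicit. Unset Printing Implicit Defensive.
Import Order.TTheory GRing.Theory Num.Theory.
Local Open Scope ring_scope.

Definition absmx (R : realFieldType) m n (X : 'M[R]_(m, n)) : 'M[R]_(m, n) :=
  map_mx (fun t => `|t|) X.

Definition lemx (R : realFieldType) m n (X Y : 'M[R]_(m, n)) : Prop :=
  forall i j, X i j <= Y i j.

(* max_i X_i / Y_i for nonnegative vectors.  Since t / 0 = 0, an index with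
   Y_i = 0 does not count; in the backward error below Y_i = 0 forces X_i = 0,
   so this is the usual convention 0 / 0 = 0. *)
Definition max_ratio (R : realFieldType) n (X Y : 'cV[R]_n) : R :=
  \big[Num.max/0]_(i < n) (X i 0 / Y i 0).

(* Standard model of floating-point arithmetic with unit roundoff eps: y is an
   admissible computed value of an operation whose exact result is x. *)
Definition fl (R : realFieldType) (eps x y : R) : Prop :=
  exists2 delta, `|delta| <= eps & y = x * (1 + delta).

Definition flmx (R : realFieldType) m n (eps : R) (X Y : 'M[R]_(m, n)) : Prop :=
  forall i j, fl eps (X i j) (Y i j).

(* y is a computed value of the sum of s, for some order and some
   parenthesization of the additions. *)
Inductive fl_sum (R : realFieldType) (eps : R) : seq R -> R -> Prop :=
| fl_sum_single x : fl_sum eps [:: x] x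
| fl_sum_cat s1 s2 y1 y2 y :
    fl_sum eps s1 y1 -> fl_sum eps s2 y2 -> fl eps (y1 + y2) y ->
    fl_sum eps (s1 ++ s2) y
| fl_sum_perm s1 s2 y :
    perm_eq s1 s2 -> fl_sum eps s1 y -> fl_sum eps s2 y.

Definition fl_dot (R : realFieldType) n (eps : R) (a : 'rV[R]_n) (s : 'cV[R]_n)
    (y : R) : Prop :=
  exists2 p : 'I_n -> R, (forall j, fl eps (a 0 j * s j 0) (p j))
                       & fl_sum eps [seq p j | j <- enum 'I_n] y.

Definition gamma_tilde (R : realFieldType) (c k : nat) (eps : R) : R :=
  (c * k)%:R * eps / (1 - (c * k)%:R * eps).

Definition backward_stable_solve (R : realFieldType) n (c : nat) (eps : R)
    (A : 'M[R]_n) (f s : 'cV[R]_n) : Prop :=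
  exists2 Delta : 'M[R]_n, (A + Delta) *m s = f
    & lemx (absmx Delta)
           (gamma_tilde c (n ^ 2) eps *: (const_mx 1 *m absmx A)).

(* All computed quantities ("hats") of one run of SM-IR. *)
Record sm_ir_values (R : realFieldType) (n : nat) := SMIRValues {
  hy : 'cV[R]_n;
  hz : 'cV[R]_n;
  halpha : R;
  hbeta : R;
  htheta : R;
  hx : 'cV[R]_n;
  hr : 'cV[R]_n;
  hyr : 'cV[R]_n;
  halphar : R;
  hthetar : R;
  hw : 'cV[R]_n
}.

Definition sm_step (R : realFieldType) n (c : nat) (eps : R) (A : 'M[R]_n)
    (u v b : 'cV[R]_n) (o : sm_ir_values R n) : Prop :=
  backward_stable_solve c eps A b (hy o) /\
  backward_stable_solve c eps A u (hz o) /\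
  fl_dot eps v^T (hy o) (halpha o) /\
  (exists2 s, fl_dot eps v^T (hz o) s & fl eps (1 + s) (hbeta o)) /\
  hbeta o != 0 /\
  fl eps (halpha o / hbeta o) (htheta o) /\
  (exists2 q, flmx eps (htheta o *: hz o) q & flmx eps (hy o - q) (hx o)).

(* r = b - A x - (v^T x) u; s is the computed scalar v^T x. *)
Definition fl_residual (R : realFieldType) n (eps : R) (A : 'M[R]_n)
    (u v b x r : 'cV[R]_n) : Prop :=
  exists p : 'cV[R]_n, exists s : R, exists t : 'cV[R]_n,
    (forall i, fl_dot eps (row i A) x (p i 0)) /\
    fl_dot eps v^T x s /\
    flmx eps (s *: u) t /\
    forall i, fl_sum eps [:: b i 0; - p i 0; - t i 0] (r i 0).

Definition ir_step (R : realFieldType) n (c : nat) (eps : R) (A : 'M[R]_n)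
    (u v b : 'cV[R]_n) (o : sm_ir_values R n) : Prop :=
  fl_residual eps A u v b (hx o) (hr o) /\
  backward_stable_solve c eps A (hr o) (hyr o) /\
  fl_dot eps v^T (hyr o) (halphar o) /\
  fl eps (halphar o / hbeta o) (hthetar o) /\
  (exists2 q : 'cV[R]_n, flmx eps (hthetar o *: hz o) q
    & forall i, fl_sum eps [:: hx o i 0; hyr o i 0; - q i 0] (hw o i 0)).

Definition sm_ir_run (R : realFieldType) n (c : nat) (eps : R) (A : 'M[R]_n)
    (u v b : 'cV[R]_n) (o : sm_ir_values R n) : Prop :=
  sm_step c eps A u v b o /\ ir_step c eps A u v b o.

(* |A + u v^T| |w| + |b| *)
Definition cw_scale (R : realFieldType) n (A : 'M[R]_n) (u v b w : 'cV[R]_n)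
    : 'cV[R]_n :=
  absmx (A + u *m v^T) *m absmx w + absmx b.

Definition cw_backward_error (R : realFieldType) n (A : 'M[R]_n)
    (u v b w : 'cV[R]_n) : R :=
  max_ratio (absmx (b - (A + u *m v^T) *m w)) (cw_scale A u v b w).

(* (2 d n^2 e e^T + 3 I) |A| + 2 (n + 4) |u| |v|^T *)
Definition h_matrix (R : realFieldType) n (d : nat) (A : 'M[R]_n)
    (u v : 'cV[R]_n) : 'M[R]_n :=
  ((2 * d * n ^ 2)%:R *: const_mx 1 + 3%:R%:M) *m absmx A
  + (2 * (n + 4))%:R *: (absmx u *m (absmx v)^T).

Definition h_vector (R : realFieldType) n (d : nat) (A : 'M[R]_n)
    (u v : 'cV[R]_n) (o : sm_ir_values R n) : 'cV[R]_n :=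
  let rho := `|halphar o| / `|hbeta o| in
  h_matrix d A u v *m (rho *: absmx (invmx A *m u)) + (2%:R * rho) *: absmx u.

(* Cancellation in A + u v^T, relative to |A + u v^T| |w| + |b|.  The residual
   is evaluated with A and u v^T apart, so its rounding error is governed by
   (|A| + |u| |v|^T) |w|, which no multiple of |A + u v^T| |w| + |b| depending
   on n alone can bound. *)
Definition cancellation (R : realFieldType) n (A : 'M[R]_n)
    (u v b w : 'cV[R]_n) : R :=
  max_ratio ((absmx A + absmx u *m (absmx v)^T) *m absmx w)
            (cw_scale A u v b w).

(* The terms of the error analysis that are dropped "to first order": eps times
   a quantity that itself tends to 0 with eps, relative to cw_scale.  They
   come from replacing hx by hw, hyr by (hw - hx) + hthetar * hz, and hz by
   A^-1 u.  The term h is not among them. *)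
Definition second_order (R : realFieldType) n (d : nat) (eps : R) (A : 'M[R]_n)
    (u v b : 'cV[R]_n) (o : sm_ir_values R n) : R :=
  eps * max_ratio
    (h_matrix d A u v *m
       (absmx (hw o - hx o) + eps *: absmx (hw o)
        + (`|halphar o| / `|hbeta o|) *: absmx (hz o - invmx A *m u)))
    (cw_scale A u v b (hw o)).

(* Main.v *)
Require Import Defs.
From HB Require Import structures.
From mathcomp Require Import all_boot all_order all_algebra.
From mathcomp Require Import zify ring lra.
Set Implicit Arguments. Unset Strict Implicit. Unset Printing Implicit Defensive.
Import Order.TTheory GRing.Theory Num.Theory.
Local Open Scope ring_scope.

(* Put B = A + u v^T.  Up to rounding, w = x + y_r - theta_r z, and b - B w
   splits into the rounding error of the computed residual, the backward errors
   of the solves for y_r and theta_r z, the rounding error of w, and u times the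
   error of theta_r (1 + v^T z) - v^T y_r.  Each is at most eps times
   |b| + |B||w|, n (|A| + |u||v|^T)|w| or the matrix H of h applied to |w - x|,
   |y_r| and |theta_r||z|.  Since y_r = (w - x) + theta_r z + O(eps), the vectors
   |y_r| and |theta_r||z| reduce to rho |A^-1 u|, with rho = |alpha_r| / |beta|,
   which the hypothesis on h controls, and to the second-order terms.

   The second-order terms are O(eps^2) for fixed data: x is O(eps)-close to the
   exact solution, hence r, y_r, alpha_r, theta_r and w - x are O(eps), while
   beta stays away from 0 because 1 + v^T A^-1 u <> 0 when B is nonsingular. *)

(** * Rounding errors of sums and inner products *)

Section Rounding.

Variables (R : realFieldType) (eps : R).

Lemma fl_err (x y : R) : fl eps x y -> `|y - x| <= eps * `|x|.
Proof.
case=> delta le_delta ->.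
have -> : x * (1 + delta) - x = delta * x by ring.
by rewrite normrM ler_wpM2r.
Qed.

(** The error is measured against a scale [T] that dominates [|x|], such as a sum of absolute
    values, so cancellation in [x] does no harm. One more rounding multiplies the growth factor
    [1 + e] by [1 + eps]. *)
Lemma fl_err_trans (T x x' y e : R) :
  0 <= eps -> fl eps x' y -> `|x' - x| <= e * T -> `|x| <= T ->
  `|y - x| <= ((1 + e) * (1 + eps) - 1) * T.
Proof.
move=> eps_ge0 /fl_err fl_y le_x' le_x.
have le_x'T : `|x'| <= (1 + e) * T.
  by rewrite mulrDl mul1r -[x'](subrK x) addrC (le_trans (ler_normD _ _)) ?lerD.
rewrite -[y](subrK x') -addrA (le_trans (ler_normD _ _))//.
have := ler_wpM2l eps_ge0 le_x'T; lra.
Qed.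

(** Induction on the tree of additions: both subsums of a node fit the growth factor
    [(1 + eps) ^+ m.-1], and the addition at the node contributes the last factor. Nonemptiness is
    carried along because the exponents are predecessors of sizes. *)
Lemma fl_sum_err (s : seq R) (y : R) : 0 <= eps -> fl_sum eps s y ->
  (0 < size s)%N /\
  `|y - \sum_(x <- s) x| <= ((1 + eps) ^+ (size s).-1 - 1) * \sum_(x <- s) `|x|.
Proof.
move=> eps_ge0; elim=> [x | s1 s2 y1 y2 {}y _ [n1 IH1] _ [n2 IH2] fl_y | s1 s2 {}y eq_s _ [n1 IH]].
- by rewrite !big_seq1 subrr normr0 expr0 subrr mul0r.
- split; first by rewrite size_cat addn_gt0 n1.
  rewrite size_cat !big_cat /=.
  set m := (size s1 + size s2).-1.
  have m_gt0 : (0 < m)%N by lia.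
  have mono k : (k <= m.-1)%N -> (1 + eps) ^+ k - 1 <= (1 + eps) ^+ m.-1 - 1.
    by move=> le_k; rewrite lerB// ler_weXn2l// lerDl.
  have le1 : ((size s1).-1 <= m.-1)%N by lia.
  have le2 : ((size s2).-1 <= m.-1)%N by lia.
  have -> : (1 + eps) ^+ m = (1 + ((1 + eps) ^+ m.-1 - 1)) * (1 + eps).
    by rewrite -{1}(prednK m_gt0) exprSr; ring.
  apply: fl_err_trans eps_ge0 fl_y _ _; last first.
    by rewrite (le_trans (ler_normD _ _))// lerD// ler_norm_sum.
  rewrite opprD addrACA (le_trans (ler_normD _ _))// mulrDr lerD//.
    by rewrite (le_trans IH1)// ler_wpM2r ?sumr_ge0// mono.
  by rewrite (le_trans IH2)// ler_wpM2r ?sumr_ge0// mono.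
- by rewrite -(perm_size eq_s) -!(perm_big _ eq_s).
Qed.

(** Each induction step creates a cross term [2 m eps * eps], which smallness bounds by [eps]; the
    factor 2 pays for it. *)
Lemma expr1D_sub1_le (m : nat) : 0 <= eps -> 2%:R * m%:R * eps <= 1 ->
  (1 + eps) ^+ m - 1 <= 2%:R * m%:R * eps.
Proof.
move=> eps_ge0; elim: m => [|m IH]; first by rewrite expr0 subrr mulr0 mul0r.
rewrite exprSr -[m.+1%:R]natr1 => le1.
have m_ge0 : 0 <= m%:R :> R by [].
have le_me : 2%:R * m%:R * eps <= 1 by lra.
have := ler_wpM2r (addr_ge0 ler01 eps_ge0) (IH le_me).
have := ler_wpM2r eps_ge0 le_me; lra.
Qed.

Lemma fl_sum3_err (a b c y : R) : 0 <= eps -> eps <= 1 -> fl_sum eps [:: a; b; c] y ->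
  `|y - (a + b + c)| <= 3%:R * eps * (`|a| + `|b| + `|c|).
Proof.
move=> eps_ge0 eps_le1 /(fl_sum_err eps_ge0)[_] /=.
rewrite !big_cons !big_nil !addr0 !addrA => /le_trans; apply.
(* The constant 3 comes from [(1 + eps)^2 - 1 = 2 eps + eps^2]. *)
rewrite ler_wpM2r ?addr_ge0//; nra.
Qed.

Lemma fl_dot_err n (a : 'rV[R]_n) (s : 'cV[R]_n) (y : R) :
  0 <= eps -> 2%:R * n%:R * eps <= 1 -> fl_dot eps a s y ->
  `|y - (a *m s) 0 0| <= 2%:R * n%:R * eps * (absmx a *m absmx s) 0 0.
Proof.
move=> eps_ge0 le1 [p fl_p /(fl_sum_err eps_ge0)[]].
rewrite size_map size_enum_ord => n_gt0.
rewrite !big_map -!enumT !big_enum /= => le_y.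
set T := (absmx a *m absmx s) 0 0.
have T_ge0 : 0 <= T by rewrite /T mxE sumr_ge0// => j _; rewrite !mxE mulr_ge0.
have TE : T = \sum_j `|a 0 j * s j 0|.
  by rewrite /T mxE; apply: eq_bigr => j _; rewrite !mxE normrM.
(* The summation accounts for [n - 1] factors [1 + eps], the rounding of the products for one
   more. *)
apply: le_trans (_ : ((1 + eps) ^+ n - 1) * T <= _); last first.
  by rewrite ler_wpM2r// expr1D_sub1_le.
have errp : \sum_j `|p j - a 0 j * s j 0| <= eps * T.
  by rewrite TE mulr_sumr ler_sum// => j _; apply: fl_err.
have sump : \sum_j `|p j| <= (1 + eps) * T.
  rewrite mulrDl mul1r addrC (le_trans _ (lerD errp (lexx T)))// TE -big_split.
  by rewrite ler_sum// => j _; rewrite -[X in `|X| <= _](subrK (a 0 j * s j 0)) ler_normD.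
have E_ge0 : 0 <= (1 + eps) ^+ n.-1 - 1.
  by rewrite subr_ge0 exprn_ege1// lerDl.
rewrite mxE -[y](subrK (\sum_j p j)) -addrA.
rewrite (le_trans (ler_normD _ _))//.
have le2 : `|\sum_j p j - \sum_j a 0 j * s j 0| <= eps * T.
  by rewrite -sumrB (le_trans (ler_norm_sum _ _ _)).
rewrite -[in X in _ <= X](prednK n_gt0) exprSr.
have := ler_wpM2l E_ge0 sump; lra.
Qed.

End Rounding.

(** * Entrywise inequalities and absolute values of matrices *)

Section EntrywiseOrder.

Variable R : realFieldType.

Lemma lemx_trans m n (X Y Z : 'M[R]_(m, n)) : lemx X Y -> lemx Y Z -> lemx X Z.
Proof. by move=> XY YZ i j; apply: le_trans (XY i j) (YZ i j). Qed.

Lemma absmx_ge0 m n (X : 'M[R]_(m, n)) : lemx 0 (absmx X).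
Proof. by move=> i j; rewrite !mxE. Qed.

Lemma lemx_mul2l m n p (H : 'M[R]_(m, n)) (X Y : 'M[R]_(n, p)) :
  lemx 0 H -> lemx X Y -> lemx (H *m X) (H *m Y).
Proof.
move=> H0 XY i j; rewrite !mxE ler_sum// => k _.
by rewrite ler_wpM2l//; have := H0 i k; rewrite mxE.
Qed.

Lemma lemx_mul2r m n p (H H' : 'M[R]_(m, n)) (X : 'M[R]_(n, p)) :
  lemx 0 X -> lemx H H' -> lemx (H *m X) (H' *m X).
Proof.
move=> X0 HH i j; rewrite !mxE ler_sum// => k _.
by rewrite ler_wpM2r//; have := X0 k j; rewrite mxE.
Qed.

Lemma mulmx_ge0 m n p (X : 'M[R]_(m, n)) (Y : 'M[R]_(n, p)) :
  lemx 0 X -> lemx 0 Y -> lemx 0 (X *m Y).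
Proof. by move=> X0 Y0; rewrite -(mulmx0 _ X); apply: lemx_mul2l. Qed.

Lemma absmxM m n p (X : 'M[R]_(m, n)) (Y : 'M[R]_(n, p)) :
  lemx (absmx (X *m Y)) (absmx X *m absmx Y).
Proof.
move=> i j; rewrite !mxE (le_trans (ler_norm_sum _ _ _))// ler_sum// => k _.
by rewrite !mxE normrM.
Qed.

Lemma absmxD m n (X Y : 'M[R]_(m, n)) :
  lemx (absmx (X + Y)) (absmx X + absmx Y).
Proof. by move=> i j; rewrite !mxE ler_normD. Qed.

Lemma absmx_outer n (u v : 'cV[R]_n) :
  absmx (u *m v^T) = absmx u *m (absmx v)^T.
Proof. by apply/matrixP=> i j; rewrite !mxE !big_ord1 !mxE normrM. Qed.

Lemma absmx_tr m n (X : 'M[R]_(m, n)) : absmx X^T = (absmx X)^T.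
Proof. by apply/matrixP=> i j; rewrite !mxE. Qed.

Lemma outer_mul_entry n (u : 'cV[R]_n) (a : 'rV[R]_n) (x : 'cV[R]_n) i :
  (u *m a *m x) i 0 = u i 0 * (a *m x) 0 0.
Proof. by rewrite -mulmxA mxE big_ord1. Qed.

(** These one-layer forms of [mxE] leave matrix products folded, so that [ring] treats the entries
    of a product as atoms. *)
Lemma mxN_entry m n (X : 'M[R]_(m, n)) i j : (- X) i j = - X i j.
Proof. by rewrite mxE. Qed.

Lemma mxB_entry m n (X Y : 'M[R]_(m, n)) i j :
  (X - Y) i j = X i j - Y i j.
Proof. by rewrite !mxE. Qed.

Lemma mxD_entry m n (X Y : 'M[R]_(m, n)) i j :
  (X + Y) i j = X i j + Y i j.
Proof. by rewrite mxE. Qed.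

Lemma mxZ_entry m n a (X : 'M[R]_(m, n)) i j :
  (a *: X) i j = a * X i j.
Proof. by rewrite mxE. Qed.

End EntrywiseOrder.

(* [Ld], [Lw], [Le], [Ly], [Lz], [La] stand for an entry of H applied to |w - x|,
   |w|, |z - A^-1 u|, |y_r|, |z|, |A^-1 u|; [f1], ..., [f5] for the five error
   terms of residual_decomposition, and [theta] for |theta_r|. *)
Lemma first_order_combination (c : nat) (F : realFieldType)
    (e rho theta Ld Lw Le Ly Lz La b0 Bw h n0 Nx Nw f1 f2 f3 f4 f5 : F) :
  0 <= e -> 0 <= rho -> 0 <= theta -> theta <= 2%:R * rho ->
  0 <= Ld -> 0 <= Lw -> 0 <= Le -> 0 <= Lz ->
  f1 <= 3%:R * e * b0 + 13%:R * n0 * e * Nx -> n0 * Nx <= n0 * Nw + Ld ->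
  f2 <= c%:R * e * Ly -> f3 <= c%:R * e * Lz ->
  f4 <= 12%:R * e * (Ly + theta * Lz) ->
  f5 <= 3%:R * e * (Bw + Ld + Ly) + 7%:R * e * (theta * Lz) ->
  Ly <= 3%:R * Ld + 6%:R * e * Lw + 6%:R * (theta * Lz) ->
  Lz <= La + Le -> rho * La <= h ->
  f1 + f2 + theta * f3 + f4 + f5
    <= e * (3%:R * b0 + 3%:R * Bw + 13%:R * n0 * Nw
            + (14 * c + 240)%:R * (h + (Ld + e * Lw + rho * Le))).
Proof.
move=> e_ge0 rho_ge0 theta_ge0 le_theta Ld_ge0 Lw_ge0 Le_ge0 Lz_ge0.
move=> f1P NP f2P f3P f4P f5P LyP LzP hP.
set P := h + _.
have eLw_ge0 : 0 <= e * Lw by rewrite mulr_ge0.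
have rhoLe_ge0 : 0 <= rho * Le by rewrite mulr_ge0.
have Z2 : rho * Lz <= h + rho * Le by have := ler_wpM2l rho_ge0 LzP; lra.
have rhoLz_ge0 : 0 <= rho * Lz by rewrite mulr_ge0.
have Z_le : theta * Lz <= 2%:R * (rho * Lz) by rewrite mulrA ler_wpM2r.
have LdP : Ld <= P by rewrite /P; lra.
have ZP : theta * Lz <= 2%:R * P by rewrite /P; lra.
have YP : Ly <= 12%:R * P by rewrite /P; lra.
have {}f3P : theta * f3 <= c%:R * e * (theta * Lz).
  by rewrite mulrCA ler_wpM2l.
have ce_ge0 : 0 <= c%:R * e :> F by rewrite mulr_ge0.
have eN := ler_wpM2l e_ge0 NP; have eLd := ler_wpM2l e_ge0 LdP.
have eZ := ler_wpM2l e_ge0 ZP; have eY := ler_wpM2l e_ge0 YP.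
have ceZ := ler_wpM2l ce_ge0 ZP; have ceY := ler_wpM2l ce_ge0 YP.
have eP_ge0 : 0 <= e * P by rewrite mulr_ge0// (le_trans Ld_ge0).
(* The coefficients of [e * P]: 13 from [f1], [12 c] from [f2], [2 c] from [theta * f3],
   [12 (12 + 2) = 168] from [f4], and [3 (1 + 12) + 7 * 2 = 53] from [f5]. They add up to
   [14 c + 234]. *)
rewrite natrD natrM; clearbody P; lra.
Qed.

(** * Bound on the residual of the corrected solution for a fixed [eps] *)

Section ErrorAnalysis.

Variables (R : realFieldType) (n c d : nat) (eps : R).
Variables (A : 'M[R]_n) (u v b : 'cV[R]_n).

Local Notation B := (A + u *m v^T).
Local Notation N := (absmx A + absmx u *m (absmx v)^T).
Local Notation H := (h_matrix d A u v).

(** The residual is exactly [Delta *m s]. The factor 2 stays inside the matrix so that [n^2] times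
    that matrix can be compared with [H]. *)
Lemma solve_residual_err (f s : 'cV[R]_n) : 0 <= eps ->
  2%:R * (c * n ^ 2)%:R * eps <= 1 -> backward_stable_solve c eps A f s ->
  lemx (absmx (f - A *m s))
       ((c * n ^ 2)%:R * eps *: ((2%:R *: (const_mx 1 *m absmx A)) *m absmx s)).
Proof.
move=> eps_ge0 le1 [Delta <- le_Delta] i j.
have -> : (A + Delta) *m s - A *m s = Delta *m s.
  by rewrite mulmxDl addrAC subrr add0r.
set t := _ * eps.
have t_ge0 : 0 <= t by rewrite mulr_ge0.
(* Since [t <= 1/2], the denominator [1 - t] is at least [1/2]. *)
have le_gamma : gamma_tilde c (n ^ 2) eps <= t * 2%:R.
  have lt1 : 2%:R * t <= 1 by rewrite mulrA.
  by rewrite /gamma_tilde -/t ler_pdivrMr; nra.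
have {}le_Delta : lemx (absmx Delta) (t *: (2%:R *: (const_mx 1 *m absmx A))).
  apply: lemx_trans le_Delta _ => k l; rewrite scalerA mxE [leRHS]mxE.
  by rewrite ler_wpM2r// mxE sumr_ge0// => q _; rewrite !mxE mul1r.
rewrite (le_trans (absmxM Delta s i j))// scalemxAl.
exact: lemx_mul2r (absmx_ge0 s) le_Delta i j.
Qed.

Lemma fl_residual_err (x r : 'cV[R]_n) i : (0 < n)%N -> 0 <= eps ->
  2%:R * n%:R * eps <= 1 -> fl_residual eps A u v b x r ->
  `|(r - (b - B *m x)) i 0|
    <= 3%:R * eps * `|b i 0| + 13%:R * n%:R * eps * (N *m absmx x) i 0.
Proof.
move=> n_gt0 eps_ge0 le1 [p [s [t [fl_p [fl_s [fl_t fl_r]]]]]].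
have n_ge1 : 1 <= n%:R :> R by rewrite ler1n.
have eps_le : eps <= n%:R * eps by rewrite ler_peMl.
have rowM (C : 'M[R]_n) (y : 'cV[R]_n) : (row i C *m y) 0 0 = (C *m y) i 0.
  by rewrite -row_mul mxE.
have absrow : absmx (row i A) = row i (absmx A).
  by apply/matrixP=> k l; rewrite !mxE.
have err_p := fl_dot_err eps_ge0 le1 (fl_p i).
rewrite absrow !rowM in err_p.
have err_s := fl_dot_err eps_ge0 le1 fl_s.
have le_p := absmxM A x i 0; rewrite mxE in le_p.
have le_s := absmxM v^T x 0 0; rewrite mxE in le_s.
have := fl_err (fl_t i 0); rewrite mxE => err_t.
have eps_le1 : eps <= 1 by lra.
have := fl_sum3_err eps_ge0 eps_le1 (fl_r i); rewrite !normrN => err_r.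
have -> : (N *m absmx x) i 0
    = (absmx A *m absmx x) i 0 + `|u i 0| * (absmx v^T *m absmx x) 0 0.
  by rewrite mulmxDl mxE -absmx_tr outer_mul_entry [absmx u _ _]mxE.
have -> : (r - (b - B *m x)) i 0
    = r i 0 - (b i 0 - ((A *m x) i 0 + u i 0 * (v^T *m x) 0 0)).
  by rewrite -outer_mul_entry mulmxDl 5!mxE.
move: le_p le_s err_p err_s err_t err_r.
move: (p i 0) (t i 0) (r i 0) (b i 0) (u i 0) => p0 t0 r0 b0 u0.
move: (A *m x) (absmx A *m absmx x) => ax absax.
move: (ax i 0) (absax i 0) => a0 X {ax absax}.
move: ((v^T *m x) 0 0) ((absmx v^T *m absmx x) 0 0) => s0 S.
move=> le_p le_s err_p err_s err_t err_r.
have X_ge0 : 0 <= X := le_trans (normr_ge0 _) le_p.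
have S_ge0 : 0 <= S := le_trans (normr_ge0 _) le_s.
have le_p0 : `|p0| <= 2%:R * X.
  have := ler_normD (p0 - a0) a0; rewrite subrK.
  have := ler_wpM2r X_ge0 le1; lra.
have le_s' : `|s| <= 2%:R * S.
  have := ler_normD (s - s0) s0; rewrite subrK.
  have := ler_wpM2r S_ge0 le1; lra.
have le_su : `|s * u0| <= 2%:R * S * `|u0| by rewrite normrM ler_wpM2r.
have U_ge0 : 0 <= S * `|u0| by rewrite mulr_ge0.
have le_esu := ler_wpM2l eps_ge0 le_su.
have eps_half : 2%:R * eps <= 1 by lra.
have le_t0 : `|t0| <= 3%:R * (S * `|u0|).
  have := ler_normD (t0 - s * u0) (s * u0); rewrite subrK.
  have := ler_wpM2r U_ge0 eps_half; lra.
have err_t' : `|t0 - u0 * s0| <= 4%:R * (n%:R * eps) * (S * `|u0|).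
  have -> : t0 - u0 * s0 = (t0 - s * u0) + (s - s0) * u0 by ring.
  have := ler_normD (t0 - s * u0) ((s - s0) * u0); rewrite [`|(s - s0) * u0|]normrM.
  have := ler_wpM2r (normr_ge0 u0) err_s.
  have := ler_wpM2r U_ge0 eps_le; lra.
(* With [|p0| <= 2 X] and [|t0| <= 3 S |u0|], the final sum costs 6 and 9 times [eps]. Adding the
   errors of [p0] and [t0] gives 8 for [X] and [9 + 4 = 13] for [S |u0|], in units of [n eps]. *)
have -> : r0 - (b0 - (a0 + u0 * s0))
    = (r0 - (b0 - p0 - t0)) + (- (p0 - a0) - (t0 - u0 * s0)) by ring.
have := ler_normD (r0 - (b0 - p0 - t0)) (- (p0 - a0) - (t0 - u0 * s0)).
have := ler_normB (- (p0 - a0)) (t0 - u0 * s0); rewrite normrN.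
have := ler_wpM2l eps_ge0 le_p0; have := ler_wpM2l eps_ge0 le_t0.
have := mulr_ge0 eps_ge0 X_ge0.
have := ler_wpM2r X_ge0 eps_le; have := ler_wpM2r U_ge0 eps_le; lra.
Qed.

Lemma update_err (theta : R) (x y z q w : 'cV[R]_n) i :
  0 <= eps -> eps <= 1 -> flmx eps (theta *: z) q ->
  fl_sum eps [:: x i 0; y i 0; - q i 0] (w i 0) ->
  `|(w - (x + y - theta *: z)) i 0|
    <= 3%:R * eps * (`|x i 0| + `|y i 0|) + 7%:R * eps * (`|theta| * `|z i 0|).
Proof.
move=> eps_ge0 eps_le1 /(_ i 0)/fl_err; rewrite mxE => err_q.
move=> /(fl_sum3_err eps_ge0 eps_le1); rewrite normrN -normrM.
have -> : (w - (x + y - theta *: z)) i 0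
    = (w i 0 - (x i 0 + y i 0 - q i 0)) + (theta * z i 0 - q i 0).
  by rewrite !mxE; ring.
move: (theta * z i 0) (q i 0) => t q0 in err_q *.
move: (x i 0) (y i 0) (w i 0) => x0 y0 w0 err_w.
(* The constant 7 is [3 * 2] from the final sum plus 1 from the rounding of [q0]. *)
have le_q : `|q0| <= 2%:R * `|t|.
  have := ler_normD (q0 - t) t; rewrite subrK.
  have := ler_wpM2r (normr_ge0 t) eps_le1; lra.
have := ler_normD (w0 - (x0 + y0 - q0)) (t - q0); rewrite [`|t - q0|]distrC.
have := ler_wpM2l eps_ge0 le_q; lra.
Qed.

(** The last rounding is charged to the computed [beta] because this error is later multiplied by
    [theta], and [theta * beta] is controlled by [alpha]. *)
Lemma capacitance_err (z : 'cV[R]_n) (beta : R) :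
  0 <= eps -> 2%:R * n%:R * eps <= 1 -> 2%:R * eps <= 1 ->
  (exists2 s, fl_dot eps v^T z s & fl eps (1 + s) beta) ->
  `|beta - (1 + (v^T *m z) 0 0)|
    <= 2%:R * eps * `|beta| + 2%:R * n%:R * eps * (absmx v^T *m absmx z) 0 0.
Proof.
move=> eps_ge0 le1 eps_half [s fl_s /fl_err err_beta].
have err_s := fl_dot_err eps_ge0 le1 fl_s.
have le_s : `|1 + s| <= 2%:R * `|beta|.
  have := ler_normD (1 + s - beta) beta; rewrite subrK [`|1 + s - beta|]distrC.
  have := ler_wpM2r (normr_ge0 (1 + s)) eps_half; lra.
have := ler_wpM2l eps_ge0 le_s.
have -> : beta - (1 + (v^T *m z) 0 0) = beta - (1 + s) + (s - (v^T *m z) 0 0) by ring.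
have := ler_normD (beta - (1 + s)) (s - (v^T *m z) 0 0); lra.
Qed.

(* The scalar [theta (1 + v^T z) - v^T y] is the coefficient of [u] in the residual of [w]. *)
Lemma sm_coefficient_err (y z : 'cV[R]_n) (alpha beta theta : R) :
  (0 < n)%N -> 0 <= eps -> 2%:R * n%:R * eps <= 1 -> beta != 0 ->
  (exists2 s, fl_dot eps v^T z s & fl eps (1 + s) beta) ->
  fl_dot eps v^T y alpha -> fl eps (alpha / beta) theta ->
  `|theta * (1 + (v^T *m z) 0 0) - (v^T *m y) 0 0|
    <= 12%:R * eps * (n%:R * (absmx v^T *m absmx y) 0 0
                      + `|theta| * (n%:R * (absmx v^T *m absmx z) 0 0)).
Proof.
move=> n_gt0 eps_ge0 le1 beta_neq0 fl_beta fl_alpha /fl_err err_theta.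
have n_ge1 : 1 <= n%:R :> R by rewrite ler1n.
have eps_le : eps <= n%:R * eps by rewrite ler_peMl.
have eps_half : 2%:R * eps <= 1 by lra.
have err_beta := capacitance_err eps_ge0 le1 eps_half fl_beta.
have err_alpha := fl_dot_err eps_ge0 le1 fl_alpha.
have le_y := absmxM v^T y 0 0; rewrite mxE in le_y.
move: ((v^T *m y) 0 0) ((absmx v^T *m absmx y) 0 0) err_alpha le_y => y0 Y err_alpha le_y.
have : 0 <= (absmx v^T *m absmx z) 0 0.
  by have := absmxM v^T z 0 0; rewrite mxE; apply: le_trans.
move: ((v^T *m z) 0 0) ((absmx v^T *m absmx z) 0 0) err_beta => z0 Z err_beta Z_ge0.
have Y_ge0 : 0 <= Y := le_trans (normr_ge0 _) le_y.
have le_alpha : `|alpha| <= 2%:R * Y.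
  have := ler_normD (alpha - y0) y0; rewrite subrK.
  have := ler_wpM2r Y_ge0 le1; lra.
have err_theta' : `|theta * beta - alpha| <= eps * `|alpha|.
  have -> : theta * beta - alpha = (theta - alpha / beta) * beta by field.
  have -> : eps * `|alpha| = eps * `|alpha / beta| * `|beta|.
    by rewrite -mulrA -normrM divfK.
  by rewrite normrM ler_wpM2r.
have le_theta_beta : `|theta| * `|beta| <= 2%:R * `|alpha|.
  rewrite -normrM; have := ler_normD (theta * beta - alpha) alpha; rewrite subrK.
  have := normr_ge0 alpha; have := ler_wpM2r (normr_ge0 alpha) eps_half; lra.
(* Passing through [theta * beta] and [alpha] avoids any lower bound on [|beta|]. The three
   differences contribute 8, 2 and 2 to the coefficient of [n eps Y]. *)
have -> : theta * (1 + z0) - y0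
    = - (theta * (beta - (1 + z0))) + ((theta * beta - alpha) + (alpha - y0)) by ring.
have := ler_normD (- (theta * (beta - (1 + z0)))) ((theta * beta - alpha) + (alpha - y0)).
rewrite normrN [in leRHS]normrM.
have := ler_normD (theta * beta - alpha) (alpha - y0).
have := ler_wpM2l (normr_ge0 theta) err_beta.
have := ler_wpM2l eps_ge0 le_theta_beta; have := ler_wpM2l eps_ge0 le_alpha.
have := ler_wpM2r Y_ge0 eps_le.
have := mulr_ge0 (mulr_ge0 (ler0n R n) eps_ge0) (mulr_ge0 (normr_ge0 theta) Z_ge0).
lra.
Qed.

Lemma h_matrixE i j : H i j =
  (2 * d * n ^ 2)%:R * (const_mx 1 *m absmx A : 'M_n) i j + 3%:R * absmx A i j
  + (2 * (n + 4))%:R * (absmx u *m (absmx v)^T) i j.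
Proof.
by rewrite /h_matrix mulmxDl -scalemxAl mul_scalar_mx mxE [X in _ + X]mxE
  [X in X + _]mxE [X in X + _ + _]mxE [X in _ + X + _]mxE.
Qed.

Lemma outer_abs_ge0 i j : 0 <= (absmx u *m (absmx v)^T) i j.
Proof. by rewrite -absmx_outer mxE. Qed.

Lemma colsum_ge_entry i j : absmx A i j <= (const_mx 1 *m absmx A : 'M_n) i j.
Proof.
rewrite [leRHS]mxE (bigD1 i)//= [X in X * _]mxE mul1r lerDl sumr_ge0// => k _.
by rewrite !mxE mul1r.
Qed.

(** First of the comparisons that make [H] a common majorant for the matrices of the analysis. Here
    the part [2 d n^2 e e^T |A|] suffices, as [d >= 1]. *)
Lemma solve_le_h_matrix : (0 < d)%N ->
  lemx ((n ^ 2)%:R *: (2%:R *: (const_mx 1 *m absmx A))) H.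
Proof.
move=> d_gt0 i j; rewrite h_matrixE scalerA mxE -natrM.
have A_ge0 : 0 <= absmx A i j by rewrite mxE.
rewrite -addrA ler_wpDr ?addr_ge0 ?mulr_ge0 ?outer_abs_ge0//.
rewrite ler_wpM2r ?(le_trans A_ge0 (colsum_ge_entry i j))//.
by rewrite ler_nat mulnC leq_mul// leq_pmulr.
Qed.

Lemma split_le_h_matrix : (0 < d)%N -> lemx (n%:R *: N) H.
Proof.
move=> d_gt0 i j; rewrite h_matrixE mxE [X in _ * X <= _]mxE.
have A_ge0 : 0 <= absmx A i j by rewrite mxE.
have le_A := colsum_ge_entry i j.
rewrite mulrDr lerD//; last first.
  by rewrite ler_wpM2r ?outer_abs_ge0// ler_nat; lia.
rewrite ler_wpDr ?mulr_ge0//.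
rewrite (le_trans (ler_wpM2l (ler0n R n) le_A))// ler_wpM2r ?(le_trans A_ge0)//.
by rewrite ler_nat; nia.
Qed.

Lemma abs_le_h_matrix : (0 < n)%N -> (0 < d)%N -> lemx (absmx B) H.
Proof.
move=> n_gt0 d_gt0; apply: lemx_trans (split_le_h_matrix d_gt0).
apply: lemx_trans (absmxD _ _) _; rewrite absmx_outer => i j.
rewrite [leRHS]mxE ler_peMl ?ler1n// mxE addr_ge0 ?outer_abs_ge0//.
by rewrite mxE.
Qed.

Lemma h_matrix_ge0 : (0 < d)%N -> lemx 0 H.
Proof.
move=> d_gt0; apply: lemx_trans (split_le_h_matrix d_gt0) => i j.
by rewrite !mxE mulr_ge0// addr_ge0// sumr_ge0// => k _; rewrite !mxE mulr_ge0.
Qed.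

(** [H] times this vector is the numerator in [second_order]. *)
Definition second_order_vector (o : sm_ir_values R n) : 'cV[R]_n :=
  absmx (hw o - hx o) + eps *: absmx (hw o)
  + (`|halphar o| / `|hbeta o|) *: absmx (hz o - invmx A *m u).

(** A purely algebraic identity, free of rounding: [r], [theta u] and [B (x + y - theta z)] are
    inserted and cancel. Each summand matches one of the error bounds. *)
Lemma residual_decomposition (x y z w r : 'cV[R]_n) (theta : R) i :
  (b - B *m w) i 0
    = - (r - (b - B *m x)) i 0 + (r - A *m y) i 0 - theta * (u - A *m z) i 0
      + u i 0 * (theta * (1 + (v^T *m z) 0 0) - (v^T *m y) 0 0)
      - (B *m (w - (x + y - theta *: z))) i 0.
Proof.
have -> : u i 0 * (theta * (1 + (v^T *m z) 0 0) - (v^T *m y) 0 0)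
    = theta * u i 0 + theta * (u *m v^T *m z) i 0 - (u *m v^T *m y) i 0.
  by rewrite !outer_mul_entry; ring.
rewrite !(mulmxBr, mulmxDr, mulmxDl) -!scalemxAr.
rewrite !(mxD_entry, mxN_entry, mxZ_entry); ring.
Qed.

(** In the update error [|x|] is replaced by [|w| + |w - x|]. The update is then solved for [y_r]:
    its error contains [3 eps |y_r|], at most half of [|y_r|] because [6 eps <= 1], and this half is
    absorbed on the left. *)
Lemma correction_abs_le (o : sm_ir_values R n) :
  0 <= eps -> 6%:R * eps <= 1 -> hbeta o != 0 -> ir_step c eps A u v b o ->
  [/\ lemx (absmx (hw o - (hx o + hyr o - hthetar o *: hz o)))
        ((3%:R * eps) *: (absmx (hw o) + absmx (hw o - hx o) + absmx (hyr o))
         + (7%:R * eps) *: (`|hthetar o| *: absmx (hz o))),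
      lemx (absmx (hyr o)) (3%:R *: absmx (hw o - hx o) + (6%:R * eps) *: absmx (hw o)
         + 6%:R *: (`|hthetar o| *: absmx (hz o)))
    & `|hthetar o| <= 2%:R * (`|halphar o| / `|hbeta o|)].
Proof.
move=> eps_ge0 eps6 beta_neq0 [_ [_ [_ [/fl_err err_theta [q fl_q fl_w]]]]].
have eps_le1 : eps <= 1 by lra.
have err_w j := update_err eps_ge0 eps_le1 fl_q (fl_w j).
have err_w' j : `|(hw o - (hx o + hyr o - hthetar o *: hz o)) j 0|
    <= 3%:R * eps * (`|hw o j 0| + `|hw o j 0 - hx o j 0| + `|hyr o j 0|)
       + 7%:R * eps * (`|hthetar o| * `|hz o j 0|).
  apply: le_trans (err_w j) _.
  have := ler_normB (hw o j 0) (hw o j 0 - hx o j 0); rewrite opprB addrCA subrr addr0.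
  move=> /(ler_wpM2l eps_ge0); lra.
split=> [j k | j k |].
- by rewrite (ord1 k); have := err_w' j; rewrite !mxE.
- rewrite (ord1 k); have := err_w' j; rewrite !mxE -normrM.
  move: (hw o j 0) (hx o j 0) (hyr o j 0) (hthetar o * hz o j 0) => w x y t err.
  have : `|y| <= `|w - (x + y - t)| + `|w - x| + `|t|.
    rewrite {1}(_ : y = - (w - (x + y - t)) + (w - x) + t); last by ring.
    rewrite (le_trans (ler_normD _ _))// lerD// (le_trans (ler_normD _ _))//.
    by rewrite normrN.
  have := ler_wpM2r (normr_ge0 (w - x)) eps6.
  have := ler_wpM2r (normr_ge0 y) eps6.
  have := ler_wpM2r (normr_ge0 t) eps6.
  have := normr_ge0 (w - x); have := normr_ge0 t; lra.
- rewrite -normf_div; set t := halphar o / hbeta o in err_theta *.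
  have := ler_normD (hthetar o - t) t; rewrite subrK.
  have := ler_wpM2r (normr_ge0 t) eps_le1; lra.
Qed.

Lemma residual_bound (o : sm_ir_values R n) i :
  (0 < n)%N -> (0 < d)%N -> 0 <= eps -> 6%:R * eps <= 1 ->
  2%:R * n%:R * eps <= 1 -> 2%:R * (c * n ^ 2)%:R * eps <= 1 ->
  sm_ir_run c eps A u v b o ->
  `|(b - B *m hw o) i 0|
    <= eps * (3%:R * absmx b i 0 + 3%:R * (absmx B *m absmx (hw o)) i 0
              + 13%:R * n%:R * (N *m absmx (hw o)) i 0
              + (14 * c + 240)%:R * (h_vector d A u v o i 0
                                     + (H *m second_order_vector o) i 0)).
Proof.
move=> n_gt0 d_gt0 eps_ge0 eps6 le_n le_c [step1 step2].
have [_ [solve_z [_ [fl_beta [beta_neq0 _]]]]] := step1.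
have [fl_r [solve_y [fl_alpha [fl_theta _]]]] := step2.
have [err_w le_y le_theta] := correction_abs_le eps_ge0 eps6 beta_neq0 step2.
have err_r := fl_residual_err i n_gt0 eps_ge0 le_n fl_r.
have err_y := solve_residual_err eps_ge0 le_c solve_y i 0.
have err_z := solve_residual_err eps_ge0 le_c solve_z i 0.
have err_coef := sm_coefficient_err n_gt0 eps_ge0 le_n beta_neq0 fl_beta fl_alpha fl_theta.
have HDE (X Y : 'cV[R]_n) : (H *m (X + Y)) i 0 = (H *m X) i 0 + (H *m Y) i 0.
  by rewrite mulmxDr mxE.
have HZE t (X : 'cV[R]_n) : (H *m (t *: X)) i 0 = t * (H *m X) i 0 by rewrite -scalemxAr mxE.
have H_ge0 : lemx 0 H := h_matrix_ge0 d_gt0.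
have HX_ge0 (X : 'cV[R]_n) : 0 <= (H *m absmx X) i 0.
  by have := mulmx_ge0 H_ge0 (absmx_ge0 X) i 0; rewrite mxE.
have le_solve (X : 'cV[R]_n) :
    (n ^ 2)%:R * ((2%:R *: (const_mx 1 *m absmx A)) *m absmx X) i 0
      <= (H *m absmx X) i 0.
  have := lemx_mul2r (absmx_ge0 X) (solve_le_h_matrix d_gt0) i 0.
  by rewrite -scalemxAl mxE.
have le_split (X : 'cV[R]_n) : n%:R * (N *m absmx X) i 0 <= (H *m absmx X) i 0.
  have := lemx_mul2r (absmx_ge0 X) (split_le_h_matrix d_gt0) i 0.
  by rewrite -scalemxAl mxE.
have le_outer (X : 'cV[R]_n) :
    `|u i 0| * (n%:R * (absmx v^T *m absmx X) 0 0) <= (H *m absmx X) i 0.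
  apply: le_trans (le_split X).
  rewrite mulmxDl [X in _ <= _ * X]mxE -absmx_tr outer_mul_entry [absmx u _ _]mxE mulrCA.
  rewrite ler_wpM2l// lerDr.
  by have := mulmx_ge0 (absmx_ge0 A) (absmx_ge0 X) i 0; rewrite mxE.
have le_B (X : 'cV[R]_n) : (absmx B *m absmx X) i 0 <= (H *m absmx X) i 0.
  exact: lemx_mul2r (absmx_ge0 X) (abs_le_h_matrix n_gt0 d_gt0) i 0.
(* The part in [|w|] is kept with [N], to be measured by the cancellation factor; only the part in
   [|w - x|] is passed on to [H]. *)
have term_x : n%:R * (N *m absmx (hx o)) i 0
    <= n%:R * (N *m absmx (hw o)) i 0 + (H *m absmx (hw o - hx o)) i 0.
  have le_x : lemx (absmx (hx o)) (absmx (hw o) + absmx (hw o - hx o)).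
    move=> j k; rewrite !mxE.
    by have := ler_normB (hw o j k) (hw o j k - hx o j k); rewrite opprB addrCA subrr addr0.
  have N_ge0 : lemx 0 N.
    by rewrite -absmx_outer => j k; rewrite !mxE addr_ge0.
  have := ler_wpM2l (ler0n R n) (lemx_mul2l N_ge0 le_x i 0).
  rewrite mulmxDr [X in _ <= _ * X -> _]mxE; have := le_split (hw o - hx o); lra.
have term_y : `|(hr o - A *m hyr o) i 0| <= c%:R * eps * (H *m absmx (hyr o)) i 0.
  have := ler_wpM2l (mulr_ge0 (ler0n R c) eps_ge0) (le_solve (hyr o)).
  by move: err_y; rewrite mxE [leRHS]mxE natrM; lra.
have term_z : `|(u - A *m hz o) i 0| <= c%:R * eps * (H *m absmx (hz o)) i 0.
  have := ler_wpM2l (mulr_ge0 (ler0n R c) eps_ge0) (le_solve (hz o)).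
  by move: err_z; rewrite mxE [leRHS]mxE natrM; lra.
have term_u : `|u i 0 * (hthetar o * (1 + (v^T *m hz o) 0 0) - (v^T *m hyr o) 0 0)|
    <= 12%:R * eps * ((H *m absmx (hyr o)) i 0 + `|hthetar o| * (H *m absmx (hz o)) i 0).
  rewrite normrM (le_trans (ler_wpM2l (normr_ge0 _) err_coef))//.
  have := ler_wpM2l eps_ge0 (le_outer (hyr o)).
  have := ler_wpM2l eps_ge0 (ler_wpM2l (normr_ge0 (hthetar o)) (le_outer (hz o))); lra.
have term_w : `|(B *m (hw o - (hx o + hyr o - hthetar o *: hz o))) i 0|
    <= 3%:R * eps * ((absmx B *m absmx (hw o)) i 0 + (H *m absmx (hw o - hx o)) i 0
                     + (H *m absmx (hyr o)) i 0)
       + 7%:R * eps * (`|hthetar o| * (H *m absmx (hz o)) i 0).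
  have := absmxM B (hw o - (hx o + hyr o - hthetar o *: hz o)) i 0; rewrite mxE.
  move=> /le_trans; apply.
  have := lemx_mul2l (absmx_ge0 B) err_w i 0.
  move=> /le_trans; apply.
  have BDE (X Y : 'cV[R]_n) : (absmx B *m (X + Y)) i 0
      = (absmx B *m X) i 0 + (absmx B *m Y) i 0 by rewrite mulmxDr mxE.
  have BZE t (X : 'cV[R]_n) : (absmx B *m (t *: X)) i 0 = t * (absmx B *m X) i 0.
    by rewrite -scalemxAr mxE.
  rewrite !(BDE, BZE).
  have := ler_wpM2l eps_ge0 (le_B (hw o - hx o)).
  have := ler_wpM2l eps_ge0 (le_B (hyr o)).
  have := ler_wpM2l eps_ge0 (ler_wpM2l (normr_ge0 (hthetar o)) (le_B (hz o))); lra.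
have bound_y := lemx_mul2l H_ge0 le_y i 0.
rewrite !(HDE, HZE) in bound_y.
set rho := `|halphar o| / `|hbeta o| in le_theta *.
have rho_ge0 : 0 <= rho by rewrite divr_ge0.
(* After multiplication by [rho], the first term goes into [h] and the second into the second-order
   terms. *)
have bound_z : (H *m absmx (hz o)) i 0
    <= (H *m absmx (invmx A *m u)) i 0 + (H *m absmx (hz o - invmx A *m u)) i 0.
  rewrite -HDE; apply: lemx_mul2l => // j k; rewrite !mxE.
  by rewrite addrC (le_trans _ (ler_normD _ _))// subrK.
have -> : (H *m second_order_vector o) i 0
    = (H *m absmx (hw o - hx o)) i 0 + eps * (H *m absmx (hw o)) i 0
      + rho * (H *m absmx (hz o - invmx A *m u)) i 0.
  by rewrite /second_order_vector !(HDE, HZE).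
have bound_h : rho * (H *m absmx (invmx A *m u)) i 0 <= h_vector d A u v o i 0.
  rewrite /h_vector /= -/rho [leRHS]mxE HZE lerDl !mxE.
  by rewrite mulr_ge0// mulr_ge0.
rewrite (residual_decomposition (hx o) (hyr o) (hz o) (hw o) (hr o) (hthetar o)).
move: (HX_ge0 (hw o)) (HX_ge0 (hw o - hx o)) (HX_ge0 (hz o - invmx A *m u)).
rewrite [absmx b i 0]mxE => Lw_ge0 Ld_ge0 Le_ge0.
move: (HX_ge0 (hz o)) => Lz_ge0.
set e1 := (hr o - (b - B *m hx o)) i 0 in err_r *.
set e2 := (hr o - A *m hyr o) i 0 in term_y *.
set e3 := (u - A *m hz o) i 0 in term_z *.
set e4 := u i 0 * _ in term_u *.
set e5 := (B *m (hw o - _)) i 0 in term_w *.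
have le_sum : `|- e1 + e2 - hthetar o * e3 + e4 - e5|
    <= `|e1| + `|e2| + `|hthetar o| * `|e3| + `|e4| + `|e5|.
  rewrite -normrM (le_trans (ler_normB _ _))// lerD2r (le_trans (ler_normD _ _))//.
  rewrite lerD2r (le_trans (ler_normB _ _))// lerD2r (le_trans (ler_normD _ _))//.
  by rewrite normrN.
apply: le_trans le_sum _.
exact: first_order_combination err_r term_x term_y term_z term_u term_w bound_y
  bound_z bound_h.
Qed.

End ErrorAnalysis.

(** * Maxima of entrywise ratios *)

Section MaxRatio.

Variables (R : realFieldType) (n : nat).

Lemma max_ratio_le (X Y : 'cV[R]_n) (t : R) :
  0 <= t -> (forall i, X i 0 / Y i 0 <= t) -> max_ratio X Y <= t.
Proof. by move=> t_ge0 le_t; apply: bigmax_le. Qed.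

Lemma ratio_le_max (X Y : 'cV[R]_n) i : X i 0 / Y i 0 <= max_ratio X Y.
Proof. by rewrite /max_ratio; apply: (le_bigmax _ (fun i => X i 0 / Y i 0)). Qed.

Lemma max_ratio_ge0 (X Y : 'cV[R]_n) : 0 <= max_ratio X Y.
Proof. exact: bigmax_ge_id. Qed.

Lemma le_max_ratioM (X Y : 'cV[R]_n) i :
  0 < Y i 0 -> X i 0 <= max_ratio X Y * Y i 0.
Proof. by move=> Y_gt0; rewrite -ler_pdivrMr// ratio_le_max. Qed.

(** Trades the maximum for a finite sum, under which [bigO] is closed. *)
Lemma max_ratio_le_sum (X Y : 'cV[R]_n) :
  max_ratio X Y <= \sum_i `|X i 0 / Y i 0|.
Proof.
apply: max_ratio_le => [|i]; first by rewrite sumr_ge0.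
by rewrite (bigD1 i)//= (le_trans (ler_norm _))// lerDl sumr_ge0.
Qed.

End MaxRatio.

(** * Calculus of orders in [eps], uniform over runs *)

Section BigO.

Variables (R : realFieldType) (T : Type) (P : R -> T -> Prop).

(* The constants of bigO are uniform over all [t] with [P e t]: the run [t] of the
   algorithm may depend on [e] in an arbitrary way. *)
Definition bigO (k : nat) (f : R -> T -> R) : Prop :=
  exists K e0 : R, [/\ 0 <= K, 0 < e0 & forall e t, 0 < e -> e <= e0 -> P e t ->
    `|f e t| <= K * e ^+ k].

Lemma bigO_le k (f g : R -> T -> R) :
  (forall e t, 0 < e -> P e t -> `|f e t| <= `|g e t|) -> bigO k g -> bigO k f.
Proof.
move=> le_fg [K [e0 [K_ge0 e0_gt0 gP]]]; exists K, e0; split=> // e t e_gt0 le_e Pt.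
exact: le_trans (le_fg e t e_gt0 Pt) (gP e t e_gt0 le_e Pt).
Qed.

Lemma bigO_eq k (f g : R -> T -> R) :
  (forall e t, P e t -> f e t = g e t) -> bigO k g -> bigO k f.
Proof. by move=> fg; apply: bigO_le => e t _ Pt; rewrite fg. Qed.

Lemma bigO_cst (a : R) : bigO 0 (fun _ _ => a).
Proof. by exists `|a|, 1; split=> // e t _ _ _; rewrite mulr1. Qed.

Lemma bigO_eps : bigO 1 (fun e _ => e).
Proof.
by exists 1, 1; split=> // e t e_gt0 _ _; rewrite mul1r expr1 gtr0_norm.
Qed.

Lemma bigO0 k : bigO k (fun _ _ => 0).
Proof. by exists 0, 1; split=> // e t _ _ _; rewrite normr0 mul0r. Qed.

Lemma bigOD k f g : bigO k f -> bigO k g -> bigO k (fun e t => f e t + g e t).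
Proof.
move=> [K [e1 [K_ge0 e1_gt0 fP]]] [L [e2 [L_ge0 e2_gt0 gP]]].
exists (K + L), (Num.min e1 e2); split; rewrite ?addr_ge0 ?lt_min ?e1_gt0//.
move=> e t e_gt0; rewrite le_min => /andP[le1 le2] Pt.
by rewrite mulrDl (le_trans (ler_normD _ _))// lerD ?fP ?gP.
Qed.

Lemma bigON k f : bigO k f -> bigO k (fun e t => - f e t).
Proof. by apply: bigO_le => e t _ _; rewrite normrN. Qed.

Lemma bigOB k f g : bigO k f -> bigO k g -> bigO k (fun e t => f e t - g e t).
Proof. by move=> fO /bigON; apply: bigOD. Qed.

Lemma bigO_norm k f : bigO k f -> bigO k (fun e t => `|f e t|).
Proof. by apply: bigO_le => e t _ _; rewrite normr_id. Qed.

Lemma bigOM k l f g :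
  bigO k f -> bigO l g -> bigO (k + l) (fun e t => f e t * g e t).
Proof.
move=> [K [e1 [K_ge0 e1_gt0 fP]]] [L [e2 [L_ge0 e2_gt0 gP]]].
exists (K * L), (Num.min e1 e2); split; rewrite ?mulr_ge0 ?lt_min ?e1_gt0//.
move=> e t e_gt0; rewrite le_min => /andP[le1 le2] Pt.
by rewrite exprD mulrACA normrM ler_pM ?fP ?gP.
Qed.

Lemma bigOMl k (a : R) f : bigO k f -> bigO k (fun e t => a * f e t).
Proof. exact: bigOM (bigO_cst a). Qed.

Lemma bigO_weaken k f : bigO k.+1 f -> bigO k f.
Proof.
move=> [K [e0 [K_ge0 e0_gt0 fP]]].
exists K, (Num.min e0 1); split; rewrite ?lt_min ?e0_gt0 ?ltr01//.
move=> e t e_gt0; rewrite le_min => /andP[le_e0 le_e1] Pt.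
rewrite (le_trans (fP e t e_gt0 le_e0 Pt))// ler_wpM2l// exprS.
by rewrite ler_piMl// exprn_ge0// ltW.
Qed.

Lemma bigO_sum k (I : finType) (f : I -> R -> T -> R) :
  (forall i, bigO k (f i)) -> bigO k (fun e t => \sum_i f i e t).
Proof.
move=> fO; elim: (index_enum I) => [|i s IH].
  by apply: bigO_eq (bigO0 k) => e t _; rewrite big_nil.
by apply: bigO_eq (bigOD (fO i) IH) => e t _; rewrite big_cons.
Qed.

Lemma bigO_absorb k (w : R) f g : 0 <= w ->
  (forall e t, 0 < e -> P e t -> `|f e t| <= `|g e t| + w * e * `|f e t|) ->
  bigO k g -> bigO k f.
Proof.
move=> w_ge0 le_f [K [e0 [K_ge0 e0_gt0 gP]]].
have w2_gt0 : 0 < 2%:R * w + 1 by lra.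
(* The summand 1 keeps the inverted number positive when [w = 0]. *)
exists (2%:R * K), (Num.min e0 (2%:R * w + 1)^-1).
split; rewrite ?mulr_ge0 ?lt_min ?e0_gt0 ?invr_gt0//.
move=> e t e_gt0; rewrite le_min => /andP[le_e0 le_e1] Pt.
have we : 2%:R * (w * e) <= 1.
  have := ler_wpM2l (ltW w2_gt0) le_e1; rewrite divff ?gt_eqF//; lra.
have := gP e t e_gt0 le_e0 Pt; have := le_f e t e_gt0 Pt.
have := ler_wpM2r (normr_ge0 (f e t)) we; lra.
Qed.

(** As soon as [K e <= |a| / 2], the value [|f|] is at least [|a| / 2]. *)
Lemma bigO_inv (a : R) f : a != 0 -> bigO 1 (fun e t => f e t - a) ->
  bigO 0 (fun e t => (f e t)^-1).
Proof.
move=> a_neq0 [K [e0 [K_ge0 e0_gt0 fP]]].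
have a_gt0 : 0 < `|a| by rewrite normr_gt0.
have K2_gt0 : 0 < 2%:R * K + 1 by lra.
exists (2%:R / `|a|), (Num.min e0 (`|a| / (2%:R * K + 1))).
split; rewrite ?divr_ge0 ?lt_min ?e0_gt0 ?divr_gt0//.
move=> e t e_gt0; rewrite le_min => /andP[le_e0 le_e1] Pt.
rewrite ler_pdivlMr// in le_e1.
have fa := fP e t e_gt0 le_e0 Pt; rewrite expr1 in fa.
have f_ge : `|a| <= 2%:R * `|f e t|.
  have := ler_normB (f e t) (f e t - a); rewrite opprB addrCA subrr addr0; lra.
have f_gt0 : 0 < `|f e t| by lra.
rewrite expr0 mulr1 normfV ler_pdivlMr// mulrC ler_pdivrMr//.
Qed.

Lemma bigO_invB (a : R) f : a != 0 -> bigO 1 (fun e t => f e t - a) ->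
  (forall e t, P e t -> f e t != 0) ->
  bigO 1 (fun e t => (f e t)^-1 - a^-1).
Proof.
move=> a_neq0 fa f_neq0.
(* Uses [1/f - 1/a = - (1/a) (1/f) (f - a)]. *)
apply: bigO_eq (bigOMl (- a^-1) (bigOM (bigO_inv a_neq0 fa) fa)) => e t Pt.
by field; rewrite a_neq0 f_neq0.
Qed.

Definition bigOmx (k m n : nat) (X : R -> T -> 'M[R]_(m, n)) : Prop :=
  forall i j, bigO k (fun e t => X e t i j).

Lemma bigOmx_cst m n (X : 'M[R]_(m, n)) : bigOmx 0 (fun _ _ => X).
Proof. by move=> i j; apply: bigO_cst. Qed.

Lemma bigOmxD k m n (X Y : R -> T -> 'M[R]_(m, n)) :
  bigOmx k X -> bigOmx k Y -> bigOmx k (fun e t => X e t + Y e t).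
Proof. by move=> XO YO i j; apply: bigO_eq (bigOD (XO i j) (YO i j)) => e t _; rewrite mxE. Qed.

Lemma bigOmxZ k l m n f (X : R -> T -> 'M[R]_(m, n)) :
  bigO k f -> bigOmx l X -> bigOmx (k + l) (fun e t => f e t *: X e t).
Proof. by move=> fO XO i j; apply: bigO_eq (bigOM fO (XO i j)) => e t _; rewrite mxE. Qed.

Lemma bigOmx_mul k m n p (X : 'M[R]_(m, n)) (Y : R -> T -> 'M[R]_(n, p)) :
  bigOmx k Y -> bigOmx k (fun e t => X *m Y e t).
Proof.
move=> YO i j; apply: bigO_eq (bigO_sum (fun l => bigOMl (X i l) (YO l j))) => e t _.
by rewrite mxE.
Qed.

Lemma bigOmx_abs k m n (X : R -> T -> 'M[R]_(m, n)) :
  bigOmx k X -> bigOmx k (fun e t => absmx (X e t)).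
Proof. by move=> XO i j; apply: bigO_eq (bigO_norm (XO i j)) => e t _; rewrite mxE. Qed.

Lemma bigOmx_weaken k m n (X : R -> T -> 'M[R]_(m, n)) :
  bigOmx k.+1 X -> bigOmx k X.
Proof. by move=> XO i j; apply: bigO_weaken. Qed.

Lemma bigOmx_close k m n (X Y : R -> T -> 'M[R]_(m, n)) :
  bigOmx k (fun e t => X e t - Y e t) -> bigOmx k Y -> bigOmx k X.
Proof.
by move=> XYO YO i j; apply: bigO_eq (bigOmxD XYO YO i j) => e t _; rewrite subrK.
Qed.

Lemma bigO_max_ratio k n (X Y : R -> T -> 'cV[R]_n) :
  bigOmx k X -> (forall i, bigO 0 (fun e t => (Y e t i 0)^-1)) ->
  bigO k (fun e t => max_ratio (X e t) (Y e t)).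
Proof.
move=> XO YO.
have := bigO_sum (fun i => bigO_norm (bigOM (XO i 0) (YO i))); rewrite addn0.
apply: bigO_le => e t _ _; rewrite ger0_norm ?max_ratio_ge0//.
by rewrite ger0_norm ?sumr_ge0// max_ratio_le_sum.
Qed.

End BigO.

(** * Order in [eps] of the computed quantities for fixed data *)

Section Asymptotics.

Variables (R : realFieldType) (n c d : nat).
Variables (A : 'M[R]_n) (u v b : 'cV[R]_n).
Hypotheses (n_gt0 : (0 < n)%N) (A_unit : A \in unitmx).
Hypothesis B_unit : A + u *m v^T \in unitmx.

Local Notation B := (A + u *m v^T).
Local Notation x0 := (invmx B *m b).
Local Notation y0 := (invmx A *m b).
Local Notation z0 := (invmx A *m u).
Local Notation alpha0 := ((v^T *m y0) 0 0).
Local Notation beta0 := (1 + (v^T *m z0) 0 0).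

(** Since [B z0 = beta0 u], a vanishing [beta0] would force [z0 = 0] by invertibility of [B], and
    then [beta0 = 1]. *)
Lemma capacitance_neq0 : beta0 != 0.
Proof.
apply/eqP=> beta_eq0.
have Bz : B *m z0 = 0.
  apply/matrixP=> i j; rewrite (ord1 j) mulmxDl mulKVmx// mxE outer_mul_entry.
  by rewrite -[u i 0 in X in X + _]mulr1 -mulrDr beta_eq0 mulr0 mxE.
have z_eq0 : z0 = 0 by rewrite -(mulKmx B_unit z0) Bz mulmx0.
by move: beta_eq0; rewrite z_eq0 mulmx0 mxE addr0; apply/eqP/oner_neq0.
Qed.

(** Checked after multiplying by [B], from [B y0 = b + alpha0 u] and [B z0 = beta0 u]. *)
Lemma sherman_morrison : x0 = y0 - (alpha0 / beta0) *: z0.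
Proof.
rewrite -[RHS](mulKmx B_unit); congr (_ *m _).
apply/matrixP=> i j; rewrite (ord1 j) mulmxBr -scalemxAr !mulmxDl !mulKVmx//.
rewrite !(mxB_entry, mxD_entry, mxZ_entry) !outer_mul_entry.
by field; apply: capacitance_neq0.
Qed.

(** The runs over which [bigO] is uniform, with the smallness conditions of the bounds for fixed
    [eps]. *)
Definition admissible (e : R) (o : sm_ir_values R n) : Prop :=
  [/\ sm_ir_run c e A u v b o, 6%:R * e <= 1, 2%:R * n%:R * e <= 1
    & 2%:R * (c * n ^ 2)%:R * e <= 1].

Local Notation O := (bigO admissible).
Local Notation Omx := (bigOmx admissible).

(* The backward error is proportional to |s|, so |s| <= |A^-1 f| + O(eps)|s|, and
   the last term is absorbed for small eps. *)
Lemma solve_bigO k (f s : R -> sm_ir_values R n -> 'cV[R]_n) :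
  (forall e o, admissible e o -> backward_stable_solve c e A (f e o) (s e o)) ->
  Omx k f -> Omx k s /\ Omx k.+1 (fun e o => s e o - invmx A *m f e o).
Proof.
move=> solve fO.
(* [G] is chosen so that [|s - A^-1 f| <= e G |s|]. *)
pose G := (c * n ^ 2)%:R *: (absmx (invmx A) *m (2%:R *: (const_mx 1 *m absmx A))).
have G_ge0 i j : 0 <= G i j.
  rewrite !mxE mulr_ge0// sumr_ge0// => l _; rewrite !mxE !mulr_ge0//.
  by rewrite sumr_ge0// => q _; rewrite !mxE mul1r.
have err e o : 0 < e -> admissible e o ->
    lemx (absmx (s e o - invmx A *m f e o)) (e *: (G *m absmx (s e o))).
  move=> e_gt0 Pt; have [_ _ _ le_c] := Pt.
  have -> : s e o - invmx A *m f e o = - (invmx A *m (f e o - A *m s e o)).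
    by rewrite mulmxBr mulKmx// opprB.
  move=> i j; rewrite [leLHS]mxE [X in `|X|]mxE normrN.
  have := absmxM (invmx A) (f e o - A *m s e o) i j; rewrite mxE => /le_trans; apply.
  have := lemx_mul2l (absmx_ge0 (invmx A))
    (solve_residual_err (ltW e_gt0) le_c (solve e o Pt)) i j.
  move=> /le_trans; apply.
  by rewrite -scalemxAr mulmxA -scalemxAl scalerA mulrC.
have sO : Omx k s.
  (* Absorption is scalar while [G] couples the entries of [s], so it is applied to their 1-norm. *)
  have sumO : O k (fun e o => \sum_i `|s e o i 0|).
    have fO' := bigO_sum (fun i => bigO_norm (bigOmx_mul (invmx A) fO i 0)).
    apply: (bigO_absorb (w := \sum_i \sum_j G i j)) fO'.
      by rewrite sumr_ge0// => i _; rewrite sumr_ge0.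
    move=> e o e_gt0 Pt.
    rewrite !ger0_norm ?sumr_ge0//.
    set S := \sum_i `|s e o i 0|; rewrite -mulrA mulr_suml -big_split /= ler_sum// => i _.
    have le_s : `|s e o i 0| <= `|(s e o - invmx A *m f e o) i 0|
        + `|(invmx A *m f e o) i 0|.
      by rewrite mxB_entry (le_trans _ (ler_normD _ _))// subrK.
    have := err e o e_gt0 Pt i 0; rewrite [leLHS]mxE [leRHS]mxE [(G *m _) i 0]mxE.
    have : e * (\sum_j G i j * absmx (s e o) j 0) <= (\sum_j G i j) * (e * S).
      rewrite mulrCA ler_wpM2l ?(ltW e_gt0)// mulr_suml ler_sum// => j _.
      by rewrite ler_wpM2l// [leLHS]mxE /S (bigD1 j)//= lerDl sumr_ge0.
    lra.
  move=> i j; rewrite (ord1 j); apply: bigO_le sumO => e o _ _.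
  rewrite [leRHS]ger0_norm ?sumr_ge0// (bigD1 i)//= lerDl sumr_ge0//.
split=> // i j; rewrite (ord1 j).
have := bigOM (bigO_eps admissible) (bigOmx_mul G (bigOmx_abs sO) i 0).
apply: bigO_le => e o e_gt0 Pt.
have := err e o e_gt0 Pt i 0; rewrite [leLHS]mxE [leRHS]mxE => /le_trans; apply.
exact: ler_norm.
Qed.

Lemma fl_dot_bigO k (s : R -> sm_ir_values R n -> 'cV[R]_n) y :
  (forall e o, admissible e o -> fl_dot e v^T (s e o) (y e o)) ->
  Omx k s -> O k.+1 (fun e o => y e o - (v^T *m s e o) 0 0).
Proof.
move=> dot sO.
have := bigOMl (2%:R * n%:R)
  (bigOM (bigO_eps admissible) (bigOmx_mul (absmx v^T) (bigOmx_abs sO) 0 0)).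
apply: bigO_le => e o e_gt0 Pt; have [_ _ le_n _] := Pt.
have := fl_dot_err (ltW e_gt0) le_n (dot e o Pt); rewrite -[X in _ <= X]mulrA.
move=> /le_trans; apply; exact: ler_norm.
Qed.

Lemma z_bigO : Omx 0 (fun _ o => hz o) /\ Omx 1 (fun _ o => hz o - z0).
Proof.
apply: (solve_bigO (f := fun _ _ => u)) (bigOmx_cst _ u).
by move=> e o [[[_ [? _]] _]].
Qed.

Lemma y_bigO : Omx 0 (fun _ o => hy o) /\ Omx 1 (fun _ o => hy o - y0).
Proof.
apply: (solve_bigO (f := fun _ _ => b)) (bigOmx_cst _ b).
by move=> e o [[[? _] _]].
Qed.

Lemma mulmx_near (a : 'rV[R]_n) (s : R -> sm_ir_values R n -> 'cV[R]_n) s0 :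
  Omx 1 (fun e o => s e o - s0) ->
  O 1 (fun e o => (a *m s e o) 0 0 - (a *m s0) 0 0).
Proof.
move=> sO; apply: bigO_eq (bigOmx_mul a sO 0 0) => e o _.
by rewrite mulmxBr mxB_entry.
Qed.

Lemma bigO_via k (f g h : R -> sm_ir_values R n -> R) :
  O k (fun e o => f e o - g e o) -> O k (fun e o => g e o - h e o) ->
  O k (fun e o => f e o - h e o).
Proof.
move=> fg gh; apply: bigO_eq (bigOD fg gh) => e o _; ring.
Qed.

Lemma bigO_close k (f g : R -> sm_ir_values R n -> R) :
  O k (fun e o => f e o - g e o) -> O k g -> O k f.
Proof.
move=> fg gO; apply: bigO_eq (bigOD fg gO) => e o _; ring.
Qed.

Lemma alpha_bigO : O 1 (fun _ o => halpha o - alpha0).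
Proof.
apply: bigO_via (mulmx_near v^T y_bigO.2).
by apply: fl_dot_bigO y_bigO.1 => e o [[[_ [_ [? _]]] _]].
Qed.

(** The error bound involves the computed [hbeta] itself, so its boundedness is obtained first, by
    absorption, and the rate afterwards. *)
Lemma beta_bigO : O 1 (fun _ o => hbeta o - beta0).
Proof.
have vzO : O 1 (fun _ o => 1 + (v^T *m hz o) 0 0 - beta0).
  apply: bigO_eq (mulmx_near v^T z_bigO.2) => e o _; ring.
have dotO : O 1 (fun e o => 2%:R * n%:R * (e * (absmx v^T *m absmx (hz o)) 0 0)).
  exact: bigOMl (bigOM (bigO_eps _) (bigOmx_mul (absmx v^T) (bigOmx_abs z_bigO.1) 0 0)).
have vzO0 : O 0 (fun _ o => 1 + (v^T *m hz o) 0 0).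
  exact: bigO_close (bigO_weaken vzO) (bigO_cst _ _).
have err e o : 0 < e -> admissible e o -> `|hbeta o - (1 + (v^T *m hz o) 0 0)|
    <= 2%:R * (e * `|hbeta o|) + 2%:R * n%:R * (e * (absmx v^T *m absmx (hz o)) 0 0).
  move=> e_gt0 [[[_ [_ [_ [fl_beta _]]]] _] e6 le_n _].
  have e2 : 2%:R * e <= 1 by lra.
  have := capacitance_err (ltW e_gt0) le_n e2 fl_beta; lra.
have betaO : O 0 (fun _ o => hbeta o).
  apply: (bigO_absorb (w := 2%:R))
    (bigOD (bigO_norm vzO0) (bigO_norm (bigO_weaken dotO))) => // e o e_gt0 Pt.
  have := err e o e_gt0 Pt.
  have := ler_normD (hbeta o - (1 + (v^T *m hz o) 0 0)) (1 + (v^T *m hz o) 0 0).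
  rewrite subrK [X in _ -> _ -> _ <= X + _]ger0_norm ?addr_ge0//.
  have := ler_norm (2%:R * n%:R * (e * (absmx v^T *m absmx (hz o)) 0 0)); lra.
apply: bigO_via vzO.
have := bigOD (bigO_norm (bigOMl 2%:R (bigOM (bigO_eps _) (bigO_norm betaO)))) (bigO_norm dotO).
apply: bigO_le => e o e_gt0 Pt; rewrite [leRHS]ger0_norm ?addr_ge0//.
by rewrite (le_trans (err e o e_gt0 Pt))// lerD ?ler_norm.
Qed.

Lemma beta_neq0 e o : admissible e o -> hbeta o != 0.
Proof. by move=> [[[_ [_ [_ [_ [? _]]]]] _]]. Qed.

Lemma beta_inv_bigO : O 0 (fun _ o => (hbeta o)^-1).
Proof. exact: bigO_inv capacitance_neq0 beta_bigO. Qed.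

Lemma theta_bigO : O 1 (fun _ o => htheta o - alpha0 / beta0).
Proof.
have alphaO : O 0 (fun _ o => halpha o).
  exact: bigO_close (bigO_weaken alpha_bigO) (bigO_cst _ _).
have ratioO : O 1 (fun _ o => halpha o / hbeta o - alpha0 / beta0).
  have invO := bigO_invB capacitance_neq0 beta_bigO beta_neq0.
  apply: bigO_eq (bigOD (bigOM alpha_bigO beta_inv_bigO) (bigOMl alpha0 invO)) => e o _; ring.
apply: bigO_via ratioO.
have := bigOM (bigO_eps admissible) (bigOM alphaO beta_inv_bigO).
apply: bigO_le => e o e_gt0 [[[_ [_ [_ [_ [_ [/fl_err le_theta _]]]]]] _] _ _ _].
by rewrite (le_trans le_theta)// [leRHS]normrM (gtr0_norm e_gt0).
Qed.

Lemma sm_update_err (e theta : R) (y z q x : 'cV[R]_n) i :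
  0 <= e -> e <= 1 -> flmx e (theta *: z) q -> flmx e (y - q) x ->
  `|(x - (y - theta *: z)) i 0| <= e * (`|y i 0| + 3%:R * `|theta * z i 0|).
Proof.
move=> e_ge0 e_le1 /(_ i 0)/fl_err err_q /(_ i 0)/fl_err.
rewrite !mxB_entry; rewrite mxE in err_q *.
move: (theta * z i 0) (q i 0) (x i 0) (y i 0) => t q1 x1 y1 in err_q *.
have le_q : `|q1| <= 2%:R * `|t|.
  have := ler_normD (q1 - t) t; rewrite subrK.
  have := ler_wpM2r (normr_ge0 t) e_le1; lra.
have -> : x1 - (y1 - t) = (x1 - (y1 - q1)) + (t - q1) by ring.
have := ler_normD (x1 - (y1 - q1)) (t - q1); rewrite [`|t - q1|]distrC.
have := ler_wpM2l e_ge0 le_q; have := ler_wpM2l e_ge0 (ler_normB y1 q1); lra.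
Qed.

(** By [sherman_morrison], [x0] is the exact counterpart of [hy - htheta hz], whose ingredients are
    all accurate to first order; the rounding of the update adds another first-order term. *)
Lemma x_bigO : Omx 1 (fun _ o => hx o - x0).
Proof.
have [zO zO1] := z_bigO; have [yO yO1] := y_bigO.
have thetaO : O 0 (fun _ o => htheta o).
  exact: bigO_close (bigO_weaken theta_bigO) (bigO_cst _ _).
have exactO : Omx 1 (fun _ o => hy o - htheta o *: hz o - x0).
  move=> i j; rewrite (ord1 j).
  apply: bigO_eq (bigOB (yO1 i 0) (bigOD (bigOM theta_bigO (zO i 0))
    (bigOMl (alpha0 / beta0) (zO1 i 0)))) => e o _.
  by rewrite sherman_morrison !mxB_entry !mxZ_entry; ring.
move=> i j; rewrite (ord1 j).
apply: (bigO_eq (g := fun e o => (hx o - (hy o - htheta o *: hz o)) i 0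
    + (hy o - htheta o *: hz o - x0) i 0)) => [e o _|].
  by rewrite !mxB_entry; ring.
apply: bigOD (exactO i 0).
have := bigOM (bigO_eps admissible)
  (bigOD (bigO_norm (yO i 0)) (bigOMl 3%:R (bigO_norm (bigOM thetaO (zO i 0))))).
apply: bigO_le => e o e_gt0 [[[_ [_ [_ [_ [_ [_ [q fl_q fl_x]]]]]]] _] e6 _ _].
have e_le1 : e <= 1 by lra.
exact: le_trans (sm_update_err i (ltW e_gt0) e_le1 fl_q fl_x) (ler_norm _).
Qed.

Lemma x_bounded : Omx 0 (fun _ o => hx o).
Proof. exact: bigOmx_close (bigOmx_weaken x_bigO) (bigOmx_cst _ _). Qed.

(** As [B x0 = b], the exact residual is [- B (x - x0)], of the order of the error of [x]. *)
Lemma r_bigO : Omx 1 (fun _ o => hr o).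
Proof.
have exactO : Omx 1 (fun _ o => b - B *m hx o).
  move=> i j; apply: bigO_eq (bigON (bigOmx_mul B x_bigO i j)) => e o _.
  by rewrite mulmxBr mulKVmx// !mxB_entry opprB.
apply: bigOmx_close exactO => i j; rewrite (ord1 j).
have NO := bigOmx_mul (absmx A + absmx u *m (absmx v)^T) (bigOmx_abs x_bounded) i 0.
have := bigOM (bigO_eps admissible) (bigOD (bigO_cst _ (3%:R * `|b i 0|))
  (bigOMl (13%:R * n%:R) NO)).
apply: bigO_le => e o e_gt0 [[_ [fl_r _]] _ le_n _].
have := fl_residual_err i n_gt0 (ltW e_gt0) le_n fl_r.
move=> /le_trans; apply; apply: le_trans (ler_norm _); lra.
Qed.

Lemma yr_bigO : Omx 1 (fun _ o => hyr o).
Proof.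
have solve e o : admissible e o -> backward_stable_solve c e A (hr o) (hyr o).
  by move=> [[_ [_ [? _]]]].
exact: (solve_bigO solve r_bigO).1.
Qed.

Lemma rho_bigO : O 1 (fun _ o => `|halphar o| / `|hbeta o|).
Proof.
have alphaO : O 1 (fun _ o => halphar o).
  have dot e o : admissible e o -> fl_dot e v^T (hyr o) (halphar o).
    by move=> [[_ [_ [_ [? _]]]]].
  exact: bigO_close (bigO_weaken (fl_dot_bigO dot yr_bigO)) (bigOmx_mul v^T yr_bigO 0 0).
apply: bigO_eq (bigO_norm (bigOM alphaO beta_inv_bigO)) => e o _.
by rewrite normf_div.
Qed.

Lemma thetar_bigO : O 1 (fun _ o => hthetar o).
Proof.
apply: bigO_le (bigOMl 2%:R rho_bigO) => e o e_gt0 Pt.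
have [[_ step2] e6 _ _] := Pt.
have [_ _ le_theta] := correction_abs_le (ltW e_gt0) e6 (beta_neq0 Pt) step2.
exact: le_trans le_theta (ler_norm _).
Qed.

Lemma correction_bigO : Omx 1 (fun _ o => hw o - hx o).
Proof.
move=> i j; rewrite (ord1 j).
have thetazO := bigOM thetar_bigO (z_bigO.1 i 0).
apply: (bigO_eq (g := fun e o => (hw o - (hx o + hyr o - hthetar o *: hz o)) i 0
    + (hyr o i 0 - hthetar o * hz o i 0))) => [e o _|].
  by rewrite !mxB_entry mxD_entry mxZ_entry; ring.
apply: bigOD (bigOB (yr_bigO i 0) thetazO).
have := bigOM (bigO_eps admissible) (bigOD
  (bigOMl 3%:R (bigOD (bigO_norm (x_bounded i 0)) (bigO_norm (bigO_weaken (yr_bigO i 0)))))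
  (bigOMl 7%:R (bigO_norm (bigO_weaken thetazO)))).
apply: bigO_le => e o e_gt0 [[_ [_ [_ [_ [_ [q fl_q fl_w]]]]]] e6 _ _].
have e_le1 : e <= 1 by lra.
have := update_err (ltW e_gt0) e_le1 fl_q (fl_w i); rewrite -normrM => /le_trans; apply.
apply: le_trans (ler_norm _); lra.
Qed.

Lemma w_bigO : Omx 1 (fun _ o => hw o - x0).
Proof.
move=> i j; apply: bigO_eq (bigOD (correction_bigO i j) (x_bigO i j)) => e o _.
by rewrite !mxB_entry addrA subrK.
Qed.

Lemma w_bounded : Omx 0 (fun _ o => hw o).
Proof. exact: bigOmx_close (bigOmx_weaken w_bigO) (bigOmx_cst _ _). Qed.

(** The scale is positive at [x0] and [w] is within [O(eps)] of [x0], so the scale at [w] stays away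
    from 0. *)
Lemma cw_scale_inv_bigO i : 0 < cw_scale A u v b x0 i 0 ->
  O 0 (fun _ o => (cw_scale A u v b (hw o) i 0)^-1).
Proof.
move=> scale_gt0; apply: (bigO_inv (lt0r_neq0 scale_gt0)).
have absO : Omx 1 (fun _ o => absmx (hw o) - absmx x0).
  move=> k l; apply: bigO_le (w_bigO k l) => e o _ _.
  by rewrite !mxB_entry !mxE ler_dist_dist.
apply: bigO_eq (bigOmx_mul (absmx B) absO i 0) => e o _.
by rewrite -mxB_entry /cw_scale opprD addrACA subrr addr0 mulmxBr.
Qed.

Lemma second_order_bigO : (forall i, 0 < cw_scale A u v b x0 i 0) ->
  O 2 (fun e o => second_order d e A u v b o).
Proof.
move=> scale_gt0; apply: (bigOM (bigO_eps _)).
apply: bigO_max_ratio (fun i => cw_scale_inv_bigO (scale_gt0 i)).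
apply: bigOmx_mul; apply: bigOmxD; first apply: bigOmxD.
- exact: bigOmx_abs correction_bigO.
- exact: bigOmxZ (bigO_eps _) (bigOmx_abs w_bounded).
(* This product is of second order; it is weakened to the first order of the other two summands. *)
- by apply: (bigOmxZ rho_bigO (bigOmx_abs (bigOmx_weaken z_bigO.2))).
Qed.

End Asymptotics.

(** * From the residual bound to the componentwise backward error *)

Theorem theorem4p7 (R : realFieldType) (c d : nat) (hd : (0 < d)%N) :
  exists k : nat,
  forall (n : nat) (A : 'M[R]_n) (u v b : 'cV[R]_n),
    (0 < n)%N -> A \in unitmx -> A + u *m v^T \in unitmx ->
  exists K eps0 : R, 0 < eps0 /\
  forall (eps M : R) (o : sm_ir_values R n),
    0 < eps -> (k * n ^ 2)%:R * eps <= 1 -> 0 <= M ->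
    sm_ir_run c eps A u v b o ->
    lemx (h_vector d A u v o) (M *: cw_scale A u v b (hw o)) ->
    cw_backward_error A u v b (hw o)
      <= (k * n)%:R * (1 + M + cancellation A u v b (hw o)) * eps
         + k%:R * second_order d eps A u v b o
    /\ ((forall i, 0 < cw_scale A u v b (invmx (A + u *m v^T) *m b) i 0) ->
        eps <= eps0 ->
        k%:R * second_order d eps A u v b o <= K * eps ^+ 2).
Proof.
(* The constant of [residual_bound]; it is also large enough for [k n^2 eps <= 1] to imply all the
   smallness conditions. *)
exists (14 * c + 240)%N => n A u v b n_gt0 A_unit B_unit.
set k := (14 * c + 240)%N.
have smallness (eps : R) : 0 < eps -> (k * n ^ 2)%:R * eps <= 1 ->
    [/\ 6%:R * eps <= 1, 2%:R * n%:R * eps <= 1 & 2%:R * (c * n ^ 2)%:R * eps <= 1].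
  move=> eps_gt0 le1.
  have small m : (m <= k * n ^ 2)%N -> m%:R * eps <= 1.
    by move=> le_m; apply: le_trans le1; rewrite ler_pM2r// ler_nat.
  by split; rewrite -?natrM small//; rewrite /k; nia.
have [K [eps0 [eps0_gt0 KP]]] : exists K eps0 : R, 0 < eps0 /\
    ((forall i, 0 < cw_scale A u v b (invmx (A + u *m v^T) *m b) i 0) ->
    forall (eps : R) (o : sm_ir_values R n), 0 < eps -> eps <= eps0 -> admissible c A u v b eps o ->
    k%:R * second_order d eps A u v b o <= K * eps ^+ 2).
  (* [K] and [eps0] are chosen before positivity of the scale is assumed, hence the case
     distinction; without positivity the claim is vacuous and any constants do. *)
  have [scale_gt0|scale_le0] :=
      boolP [forall i, 0 < cw_scale A u v b (invmx (A + u *m v^T) *m b) i 0].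
  - have [K [eps0 [_ eps0_gt0 KP]]] := bigOMl k%:R
      (second_order_bigO c d n_gt0 A_unit B_unit (fun i => forallP scale_gt0 i)).
    exists K, eps0; split=> // _ eps o eps_gt0 le_eps Pt.
    exact: le_trans (ler_norm _) (KP eps o eps_gt0 le_eps Pt).
  - exists 0, 1; split=> // scale_gt0; case/negP: scale_le0; exact/forallP.
exists K, eps0; split=> // eps M o eps_gt0 /(smallness eps eps_gt0)[e6 le_n le_c].
move=> M_ge0 run le_h; split; last first.
  by move=> scale_gt0 le_eps; apply: KP.
have n_ge1 : 1 <= n%:R :> R by rewrite ler1n.
have canc_ge0 : 0 <= cancellation A u v b (hw o) by apply: max_ratio_ge0.
have second_ge0 : 0 <= second_order d eps A u v b o.
  by rewrite mulr_ge0 ?max_ratio_ge0// ltW.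
have bound_ge0 : 0 <= (k * n)%:R * (1 + M + cancellation A u v b (hw o)) * eps
    + k%:R * second_order d eps A u v b o.
  have sum_ge0 : 0 <= 1 + M + cancellation A u v b (hw o) by lra.
  by apply: addr_ge0; apply: mulr_ge0 => //; [apply: mulr_ge0 | apply: ltW].
apply: max_ratio_le => [//|i].
have [B_ge0 b_ge0] : 0 <= (absmx (A + u *m v^T) *m absmx (hw o)) i 0 /\ 0 <= absmx b i 0.
  split; last by rewrite mxE.
  by have := mulmx_ge0 (absmx_ge0 (A + u *m v^T)) (absmx_ge0 (hw o)) i 0; rewrite mxE.
have scaleE : cw_scale A u v b (hw o) i 0
    = (absmx (A + u *m v^T) *m absmx (hw o)) i 0 + absmx b i 0 by rewrite /cw_scale mxE.
(* The scale is nonnegative, so here it vanishes and the ratio is 0 by the convention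
   [t / 0 = 0]. *)
have [scale_le0|scale_gt0] := lerP (cw_scale A u v b (hw o) i 0) 0.
  have -> : cw_scale A u v b (hw o) i 0 = 0 by rewrite scaleE in scale_le0 *; lra.
  by rewrite invr0 mulr0.
rewrite ler_pdivrMr// mxE.
have := residual_bound i n_gt0 hd (ltW eps_gt0) e6 le_n le_c run.
move=> /le_trans; apply.
have le_canc := le_max_ratioM ((absmx A + absmx u *m (absmx v)^T) *m absmx (hw o)) scale_gt0.
have le_second := le_max_ratioM
  (h_matrix d A u v *m second_order_vector eps A u o) scale_gt0.
have := le_h i 0; rewrite [leRHS]mxE => {}le_h.
rewrite -/(cancellation A u v b (hw o)) in le_canc.
rewrite /second_order -/(second_order_vector eps A u o) -/k.
move: le_canc le_second le_h scaleE B_ge0 b_ge0 scale_gt0 canc_ge0.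
move: (max_ratio _ _) (cancellation _ _ _ _ _) (cw_scale _ _ _ _ _ _ _) => mu kappa s.
move=> le_canc le_second le_h scaleE B_ge0 b_ge0 scale_gt0 canc_ge0.
(* With [eps] factored out, [3 |b| + 3 |B||w|] is [3 s], the term in [N] is at most [13 n kappa s],
   and the rest at most [k (M + mu) s]. *)
rewrite [leRHS](_ : _ = eps * (s * ((k * n)%:R * (1 + M + kappa) + k%:R * mu))); last by ring.
rewrite ler_wpM2l ?(ltW eps_gt0)//.
have k_ge : 240%:R <= k%:R :> R by rewrite ler_nat /k leq_addl.
have kn_ge : k%:R <= (k * n)%:R :> R by rewrite natrM ler_peMr// ler0n.
have k_ge0 : 0 <= k%:R :> R by rewrite ler0n.
have kn_ge13 : 13%:R * n%:R <= (k * n)%:R :> R.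
  by rewrite natrM ler_wpM2r//; lra.
have s_ge0 := ltW scale_gt0.
have := ler_wpM2l k_ge0 (lerD le_h le_second).
have := ler_wpM2l (mulr_ge0 (ler0n R 13) (ler0n R n)) le_canc.
have := ler_wpM2r (mulr_ge0 canc_ge0 s_ge0) kn_ge13.
have := ler_wpM2r (mulr_ge0 M_ge0 s_ge0) kn_ge.
have := ler_wpM2r s_ge0 kn_ge; have := ler_wpM2r s_ge0 k_ge.
lra.
Qed.
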